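(* There is an absolute constant $\kappa>0$ such that for all $n$ and $S$: (1) every bounded-error randomized pair of communicating circuits with space $S$ computing $DISJ_{n,n}$ (Boolean matrix multiplication) has communication at least $\kappa n^3/S^2$; (2) every bounded-error randomized pair of communicating circuits with space $S$ computing $DISJ_{n,1}$ (Boolean matrix-vector multiplication) has communication at least $\kappa n^2/S^2$.
   Context: $DISJ(x,y)=1$ for $x,y\in\{0,1\}^n$ iff there is no $i$ with $x_i=y_i=1$. $DISJ_{l,r}$: Alice receives $x_1,\dots,x_l\in\{0,1\}^n$, Bob receives $y_1,\dots,y_r\in\{0,1\}^n$, and they output $DISJ(x_i,y_j)$ for all pairs $(i,j)$. Model (classical communicating circuits): a single randomized circuit partitioned into an Alice part and a Bob part; each part may read single bits of its owner's input; communication = number of bit wires crossing between the parts; space $S$ = at every time at most $S$ bits in use in the whole circuit. Each output is produced at a fixed predetermined point by one player and sent to the other, who may then forget it. Bounded error: with probability at least $1/2$ all outputs are correct. *)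

(* Defs.v *)
From HB Require Import structures.
From mathcomp Require Import all_boot all_order all_algebra.
Set Implicit Arguments. Unset Strict Implicit. Unset Printing Implicit Defensive.
Import Order.TTheory GRing.Theory Num.Theory.

Definition DISJ (n : nat) (x y : 'I_n -> bool) : bool :=
  [forall i, ~~ (x i && y i)].

Inductive player := Alice | Bob.

Definition other (p : player) : player :=
  match p with Alice => Bob | Bob => Alice end.

(* A communicating circuit for DISJ_{l,r} on n-bit vectors is a straight-line
   sequence of elementary steps (a topologically sorted circuit).  Each player
   owns a list of live wires (bits in use).  Steps:
   - Gate p f i j : player p computes a fan-in-2 gate f on two of its own
                    live wires, creating a new live wire of p;
   - ReadA k i / ReadB k i : Alice reads bit i of her k-th input vector
                    (resp. Bob of his), creating a new live wire;
   - Coin p       : player p creates a wire carrying a fresh random bit;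
   - Discard p i  : player p forgets its i-th live wire;
   - Send p i     : the i-th live wire of p crosses to the other player
                    (one bit of communication);
   - Output p i k : the i-th live wire of p is produced as the output for the
                    pair k = (i1, j1) and sent to the other player (one bit of
                    communication), who may later discard it. *)
Inductive instr (l r n : nat) :=
| Gate of player & (bool -> bool -> bool) & nat & nat
| ReadA of 'I_l & 'I_n
| ReadB of 'I_r & 'I_n
| Coin of player
| Discard of player & nat
| Send of player & nat
| Output of player & nat & ('I_l * 'I_r).

Definition program (l r n : nat) := seq (instr l r n).

Record state (l r : nat) := State {
  memA : seq bool;
  memB : seq bool;
  tape : seq bool;
  outs : seq (('I_l * 'I_r) * bool)
}.

Section Semantics.
Variables (l r n : nat).
Variables (x : 'I_l -> 'I_n -> bool) (y : 'I_r -> 'I_n -> bool).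

Definition mem (p : player) (s : state l r) : seq bool :=
  match p with Alice => memA s | Bob => memB s end.

Definition setmem (p : player) (m : seq bool) (s : state l r) : state l r :=
  match p with
  | Alice => State m (memB s) (tape s) (outs s)
  | Bob => State (memA s) m (tape s) (outs s)
  end.

Definition remw (m : seq bool) (i : nat) : seq bool := take i m ++ drop i.+1 m.

Definition wire (p : player) (s : state l r) (i : nat) : bool := nth false (mem p s) i.

Definition push (p : player) (b : bool) (s : state l r) : state l r :=
  setmem p (rcons (mem p s) b) s.

Definition move (p : player) (i : nat) (s : state l r) : state l r :=
  let b := wire p s i in
  push (other p) b (setmem p (remw (mem p s) i) s).

Definition step (s : state l r) (c : instr l r n) : state l r :=
  match c with
  | Gate p f i j => push p (f (wire p s i) (wire p s j)) s
  | ReadA k i => push Alice (x k i) s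
  | ReadB k i => push Bob (y k i) s
  | Coin p =>
      push p (head false (tape s))
        (State (memA s) (memB s) (behead (tape s)) (outs s))
  | Discard p i => setmem p (remw (mem p s) i) s
  | Send p i => move p i s
  | Output p i k =>
      let s' := move p i s in
      State (memA s') (memB s') (tape s') (rcons (outs s') (k, wire p s i))
  end.

Definition trace (P : program l r n) (t : seq bool) : seq (state l r) :=
  let s0 := State [::] [::] t [::] in s0 :: scanl step s0 P.

Definition final (P : program l r n) (t : seq bool) : state l r :=
  foldl step (State [::] [::] t [::]) P.

Definition all_outputs_correct (s : state l r) : bool :=
  [forall k : 'I_l * 'I_r,
     [seq kb.2 | kb <- outs s & kb.1 == k] == [:: DISJ (x k.1) (y k.2)]].

End Semantics.

Definition is_comm (l r n : nat) (c : instr l r n) : bool :=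
  match c with Send _ _ => true | Output _ _ _ => true | _ => false end.

Definition is_coin (l r n : nat) (c : instr l r n) : bool :=
  match c with Coin _ => true | _ => false end.

Definition comm (l r n : nat) (P : program l r n) : nat := count (@is_comm l r n) P.

Definition ncoins (l r n : nat) (P : program l r n) : nat := count (@is_coin l r n) P.

Definition space_bounded (l r n : nat) (P : program l r n) (S : nat) : Prop :=
  forall x y (t : seq bool),
    all (fun s => size (memA s) + size (memB s) <= S) (trace x y P t).

(* bounded error: for every input, with probability >= 1/2 over the random
   bits, all outputs are correct *)
Definition computes_DISJ (l r n : nat) (P : program l r n) : Prop :=
  forall (x : 'I_l -> 'I_n -> bool) (y : 'I_r -> 'I_n -> bool),
    2 ^ ncoins P <=
    2 * #|[set t : (ncoins P).-tuple bool |
             all_outputs_correct x y (final x y P t)]|.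

(* Main.v *)
Require Import Defs.
From mathcomp Require Import all_boot all_order all_algebra.
From mathcomp Require Import zify ring lra.
Set Implicit Arguments. Unset Strict Implicit. Unset Printing Implicit Defensive.
Import Order.TTheory GRing.Theory Num.Theory.
Local Open Scope ring_scope.

(* Cut the circuit into slices of communication about n/k with k = Theta(S).  If
   some slice produced k outputs, give each of the corresponding k pairs its own
   block of m = n/k coordinates; the slice then solves k independent instances of
   DISJ on m bits.  For each of the 2^O(S) memory contents at its beginning the
   slice is a deterministic protocol, whose transcripts partition the inputs into
   rectangles with constant answers.

   A rectangle carrying more than 2^(-Omega(m)) of Razborov's disjoint
   distribution carries a constant fraction of that mass under the intersecting
   distribution (given the partition D of the coordinates, both sides of a large
   rectangle are unbiased at most coordinates).  Exchanging disjoint for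
   intersecting instances one at a time, a rectangle whose answer claims
   "disjoint" q times is right on at most a (56/57)^q fraction of its mass, while
   random answers contain fewer than k/4 such claims with probability at most
   2^(-Omega(k)).  Hence the slice is right with probability 2^(-Omega(k)), which
   beats the 2^O(S) initial memories.  So every slice has fewer than k outputs
   and there are many slices. *)

(** * Razborov's lemma *)

Definition upd (T : finType) (C : Type) (u : {ffun T -> C}) (i : T) (c : C) :
  {ffun T -> C} := [ffun j => if j == i then c else u j].

Lemma upd_upd (T : finType) (C : Type) (u : {ffun T -> C}) i c d :
  upd (upd u i c) i d = upd u i d.
Proof. by apply/ffunP => j; rewrite !ffunE; case: eqP. Qed.

Lemma upd_id (T : finType) (C : Type) (u : {ffun T -> C}) i :
  upd u i (u i) = u.
Proof. by apply/ffunP => j; rewrite !ffunE; case: eqP => // ->. Qed.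

(* [(u, c) |-> (upd u i c, u i)] is an involution. *)
Lemma sum_upd (V : nmodType) (T C : finType) (f : {ffun T -> C} -> V) (i : T) :
  \sum_u \sum_c f (upd u i c) = (\sum_u f u) *+ #|C|.
Proof.
rewrite pair_big /=.
pose h (p : {ffun T -> C} * C) := (upd p.1 i p.2, p.1 i).
have hK : involutive h.
  by move=> [u c]; rewrite /h /= upd_upd upd_id ffunE eqxx.
rewrite (reindex_inj (inv_inj hK)) /=.
rewrite (eq_bigr (fun p => f p.1)); last first.
  by move=> [u c] _; rewrite /= upd_upd upd_id.
rewrite -(pair_big predT predT (fun u (c : C) => f u)) /= -sumrMnl.
by apply: eq_bigr => u _; rewrite sumr_const.
Qed.

Lemma sum_upd_bool (R : realFieldType) (T : finType) (f : {ffun T -> bool} -> R) (i : T) :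
  \sum_u (f (upd u i true) + f (upd u i false)) = 2 * \sum_u f u.
Proof.
rewrite mulr_natl -card_bool -(sum_upd f i); apply: eq_bigr => u _.
by rewrite big_bool.
Qed.

(* The weight of [u] is a product of 16s (agreements with [v]) and 81s; the
   choice 16/81 = (2/3)^4 makes the lower bound 54^|I| an integer power. *)
Lemma card_few_agreements (T : finType) (I : {set T}) (v : T -> bool) :
  (#|[set u : {ffun T -> bool} | 4 * #|[set i in I | u i == v i]| <= #|I|]|
     * 108 ^ #|I| <= 2 ^ #|T| * 97 ^ #|I|)%N.
Proof.
set E := [set u | _].
pose w i b := if i \in I then (if b == v i then 16 else 81)%N else 1%N.
have tot : (\sum_(u : {ffun T -> bool}) \prod_i w i (u i) * 2 ^ #|I|
            = 2 ^ #|T| * 97 ^ #|I|)%N.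
  rewrite -big_distrl /= -(bigA_distr_bigA w) /=.
  rewrite (eq_bigr (fun i => (if i \in I then 97 else 2)%N)); last first.
    by move=> i _; rewrite big_bool /w /=; case: (i \in I) => //; case: (v i).
  rewrite (bigID (mem I)) /=.
  rewrite (eq_bigr (fun=> 97%N)); last by move=> i ->.
  rewrite [X in (_ * X * _)%N](eq_bigr (fun=> 2%N)); last by move=> i /negbTE ->.
  rewrite !prod_nat_const -mulnA -expnD mulnC; congr (2 ^ _ * _)%N.
  by rewrite -(cardC (mem I)) addnC; congr (_ + _)%N; apply: eq_card.
rewrite -tot -big_distrl /= (_ : 108 = 54 * 2)%N // expnMn mulnA leq_mul2r.
apply/orP; right.
rewrite -sum_nat_const [X in (_ <= X)%N](bigID (mem E)) /=.
apply: leq_trans (leq_addr _ _); apply: leq_sum => u; rewrite inE => few.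
rewrite (bigID (mem I)) /= [X in (_ <= _ * X)%N]big1 ?muln1; last first.
  by move=> i /negbTE ni; rewrite /w ni.
rewrite (eq_bigr (fun i => (if u i == v i then 16 else 81)%N)); last first.
  by move=> i iI; rewrite /w iI.
rewrite (bigID (fun i => u i == v i)) /=.
rewrite (eq_bigr (fun=> 16%N)); last by move=> i /andP[_ ->].
rewrite [X in (_ <= _ * X)%N](eq_bigr (fun=> 81%N)); last first.
  by move=> i /andP[_ /negbTE ->].
rewrite !prod_nat_const.
set s := #|I|; set c1 := #|_|; set c2 := #|_|.
have sE : s = (c1 + c2)%N.
  by rewrite /s -(cardID [pred i | u i == v i] (mem I)) /=; congr (_ + _)%N;
     apply: eq_card => i; rewrite !inE // andbC.
have {few} few : (4 * c1 <= s)%N.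
  by apply: leq_trans few; rewrite leq_mul2l /= leq_eqVlt; apply/orP; left;
     apply/eqP; apply: eq_card => i; rewrite !inE.
(* The weight of [u] is 2^(4 c1) 3^(s - 4 c1) 27^s; lowering the middle base from 3 to 2 leaves
   54^s. *)
rewrite (_ : 54 = 2 * 3 ^ 3)%N // (_ : 16 = 2 ^ 4)%N // (_ : 81 = 3 ^ 4)%N //.
rewrite expnMn -!expnM.
have -> : (4 * c2 = (s - 4 * c1) + 3 * s)%N by lia.
rewrite expnD mulnA leq_mul2r; apply/orP; right.
rewrite -[X in (2 ^ X <= _)%N](subnKC few) expnD leq_mul2l.
by apply/orP; right; elim: (s - 4 * c1)%N => // d IH; rewrite !expnS leq_mul.
Qed.

(** Double counting: a member of [F] agrees with [v] on |I|/8 places of [I] at most on average, so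
    by Markov's inequality half of [F] agrees on at most |I|/4 places, and [card_few_agreements]
    bounds that half. *)
Lemma card_biased_coordinates (T : finType) (F : {set {ffun T -> bool}})
    (I : {set T}) (v : T -> bool) :
  (forall i, i \in I -> 8 * #|[set u in F | u i == v i]| <= #|F|)%N ->
  (#|F| * 108 ^ #|I| <= 2 * (2 ^ #|T| * 97 ^ #|I|))%N.
Proof.
move=> biased; have := card_few_agreements I v.
set E := [set u | _] => few; set s := #|I|.
pose agr (u : {ffun T -> bool}) := #|[set i in I | u i == v i]|.
have dbl : (\sum_(u in F) agr u = \sum_(i in I) #|[set u in F | u i == v i]|)%N.
  transitivity (\sum_(u in F) \sum_(i in I) (u i == v i))%N.
    by apply: eq_bigr => u _; rewrite /agr -sum1dep_card big_mkcondr.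
  rewrite exchange_big /=; apply: eq_bigr => i _.
  by rewrite -sum1dep_card big_mkcondr.
have sumI : (8 * \sum_(u in F) agr u <= s * #|F|)%N.
  rewrite dbl big_distrr /= -sum_nat_const; exact: leq_sum.
(* The strict inequality outside [E] gives [s.+1], a factor that can be cancelled even when [I] is
   empty. *)
have many : (#|F :\: E| * s.+1 <= 4 * \sum_(u in F) agr u)%N.
  rewrite -sum_nat_const big_distrr /= [X in (_ <= X)%N](bigID (mem E)) /=.
  apply: leq_trans (leq_addl _ _).
  rewrite (eq_bigl (fun u => (u \in F) && (u \notin E))); last first.
    by move=> u; rewrite !inE andbC.
  by apply: leq_sum => u /andP[_]; rewrite inE -ltnNge.
have half : (2 * #|F :\: E| <= #|F|)%N.
  rewrite -(leq_pmul2r (ltn0Sn s)) -mulnA.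
  apply: leq_trans (leq_mul (leqnn 2) many) _; rewrite mulnA.
  by apply: leq_trans sumI _; rewrite mulnC leq_mul2l leqnSn orbT.
have FE : (#|F| <= 2 * #|E|)%N.
  have := subset_leq_card (subsetIr F E); move: half; rewrite -(cardsID E F).
  move: #|F :\: E| #|F :&: E| #|E| => x y z; lia.
apply: leq_trans (leq_mul FE (leqnn _)) _.
by rewrite -mulnA leq_mul2l.
Qed.

Definition restrict (T : finType) (u D : {ffun T -> bool}) : {ffun T -> bool} :=
  [ffun i => u i && D i].

Definition compl (T : finType) (D : {ffun T -> bool}) : {ffun T -> bool} :=
  [ffun i => ~~ D i].

Section Razborov.
Variables (R : realFieldType) (T : finType).
Notation V := {ffun T -> bool}.
Implicit Types (A B : pred V) (D u : V) (i : T) (b c : bool).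

(** As [u] ranges over all sets, not only those inside [D], this is 2^|T| times the probability that
    a uniform subset of [D] lies in [A], for every [D]. *)
Definition hits A D : R := \sum_u (A (restrict u D))%:R.
Definition hits_at A D i b : R := \sum_u (A (upd (restrict u D) i b))%:R.

Lemma hits_ge0 A D : 0 <= hits A D.
Proof. exact: sumr_ge0. Qed.

Lemma hits_at_ge0 A D i b : 0 <= hits_at A D i b.
Proof. exact: sumr_ge0. Qed.

Lemma hits_le A D : hits A D <= 2 ^+ #|T|.
Proof.
rewrite -natrX -card_bool -card_ffun -sum1_card natr_sum.
by apply: ler_sum => u _; rewrite ler_nat leq_b1.
Qed.

Lemma upd_restrict u D i c b : upd (restrict u (upd D i c)) i b = upd (restrict u D) i b.
Proof. by apply/ffunP => j; rewrite !ffunE; case: eqP. Qed.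

Lemma hits_at_upd A D i c b : hits_at A (upd D i c) i b = hits_at A D i b.
Proof. by apply: eq_bigr => u _; rewrite upd_restrict. Qed.

Lemma restrict_upd u D i b : D i -> restrict (upd u i b) D = upd (restrict u D) i b.
Proof.
by move=> Di; apply/ffunP => j; rewrite !ffunE; case: eqP => // ->; rewrite Di andbT.
Qed.

Lemma hits_in A D i :
  D i -> 2 * hits A D = hits_at A D i true + hits_at A D i false.
Proof.
move=> Di; rewrite -(sum_upd_bool _ i) big_split /=.
by congr (_ + _); apply: eq_bigr => u _; rewrite restrict_upd.
Qed.

Lemma hits_out A D i : ~~ D i -> hits A D = hits_at A D i false.
Proof.
move=> /negbTE Di; apply: eq_bigr => u _; congr (A _)%:R.
by apply/ffunP => j; rewrite !ffunE; case: eqP => // ->; rewrite Di andbF.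
Qed.

(** For [i] in [D]: one of the two values at [i] is taken by less than an eighth of the hits, the
    threshold of [card_biased_coordinates]. *)
Definition biased A D i :=
  (7 * hits_at A D i true < hits_at A D i false) ||
  (7 * hits_at A D i false < hits_at A D i true).

Lemma biased_upd A D i c : biased A (upd D i c) i = biased A D i.
Proof. by rewrite /biased !hits_at_upd. Qed.

(** Either at most |T|/36 coordinates of [D] are biased, which gives the first term, or
    [card_biased_coordinates] makes [hits A D] exponentially small, which gives the second. *)
Lemma sum_biased_hits A D :
  36 * (\sum_i (D i && biased A D i)%:R) * hits A D <=
  #|T|%:R * hits A D + 72 * (9 / 10) ^+ (#|T| %/ 36) * #|T|%:R * 2 ^+ #|T|.
Proof.
pose I := [set i | D i && biased A D i].
have -> : \sum_i (D i && biased A D i)%:R = #|I|%:R :> R.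
  by rewrite -sum1dep_card natr_sum [RHS]big_mkcond; apply: eq_bigr => i _; case: ifP.
have h0 := hits_ge0 A D.
set q := (_ %/ 36)%N; set t : R := (9 / 10) ^+ q; set M : R := 2 ^+ #|T|.
have t0 : 0 <= t by apply: exprn_ge0; lra.
have M0 : 0 <= M by rewrite exprn_ge0.
have [leI|ltI] := leqP (36 * #|I|) #|T|.
  have : (36 * #|I|)%:R <= #|T|%:R :> R by rewrite ler_nat.
  have : 0 <= 72 * t * #|T|%:R * M by rewrite !mulr_ge0.
  rewrite natrM; set y := #|I|%:R; set m := #|T|%:R; set e := 72 * _ * _ * _.
  by move=> e0 le; have := ler_wpM2r h0 le; lra.
have qI : (q <= #|I|)%N by rewrite /q; lia.
pose F := [set u | A (restrict u D)].
have FE : hits A D = #|F|%:R.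
  by rewrite -sum1dep_card natr_sum [RHS]big_mkcond; apply: eq_bigr => u _; case: ifP.
have atE i b : D i -> hits_at A D i b = 2 * #|[set u in F | u i == b]|%:R.
  move=> Di.
  have -> : #|[set u in F | u i == b]|%:R = \sum_u ((u \in F) && (u i == b))%:R :> R.
    by rewrite -sum1dep_card natr_sum [LHS]big_mkcond; apply: eq_bigr => u _; case: ifP.
  rewrite -(sum_upd_bool _ i); apply: eq_bigr => u _.
  rewrite !inE !restrict_upd // !ffunE eqxx.
  by case: b; rewrite /= ?andbT ?andbF ?addr0 ?add0r.
pose v i := 7 * hits_at A D i true < hits_at A D i false.
have small i : i \in I -> (8 * #|[set u in F | u i == v i]| <= #|F|)%N.
  rewrite inE => /andP[Di bi]; rewrite -(ler_nat R) natrM -FE.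
  have := hits_in A Di; have := atE i (v i) Di; move: bi; rewrite /biased -/(v i).
  case: (boolP (v i)); rewrite /v -?leNgt /=; lra.
have := card_biased_coordinates small.
set s := #|I| in ltI qI *; set f := #|F| in FE * => le108.
have le : hits A D <= 2 * M * (97 / 108) ^+ s.
  rewrite expr_div_n mulrA ler_pdivlMr ?exprn_gt0 // FE /M.
  by rewrite -!natrX -!natrM ler_nat -mulnA.
have {le} le : hits A D <= 2 * M * t.
  apply: le_trans le _; rewrite ler_wpM2l ?mulr_ge0 //.
  apply: (@le_trans _ _ ((97 / 108) ^+ q)).
    by apply: ler_wiXn2l qI; lra.
  by rewrite lerXn2r ?nnegrE; lra.
have : s%:R <= #|T|%:R :> R by rewrite ler_nat max_card.
set x := s%:R; set m := #|T|%:R => xm.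
have x0 : 0 <= x by rewrite ler0n.
have m0 : 0 <= m by rewrite ler0n.
have : x * hits A D <= m * (2 * M * t) by apply: ler_pM.
have := mulr_ge0 m0 h0; lra.
Qed.

Lemma compl_upd D i c : compl (upd D i c) = upd (compl D) i (~~ c).
Proof. by apply/ffunP => j; rewrite !ffunE; case: eqP. Qed.

(** If neither side is biased, [a1 * b1] bounds everything, with 7 + 2 * 49 + 7 = 112. If exactly
    one is, the ratio 7 on the other side bounds the remaining term by 8 times the term of the
    biased side, hence the 9. *)
Lemma four_point (a0 a1 b0 b1 : R) (ba bb : bool) :
  0 <= a0 -> 0 <= a1 -> 0 <= b0 -> 0 <= b1 ->
  ba = (7 * a1 < a0) || (7 * a0 < a1) -> bb = (7 * b1 < b0) || (7 * b0 < b1) ->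
  (a1 + a0) * b0 + a0 * (b1 + b0) <=
  112 * (a1 * b1) + 9 * (ba%:R * ((a1 + a0) * b0)) + 9 * (bb%:R * (a0 * (b1 + b0))).
Proof.
move=> a00 a10 b00 b10 -> ->.
have p00 := mulr_ge0 a00 b00; have p01 := mulr_ge0 a00 b10.
have p10 := mulr_ge0 a10 b00; have p11 := mulr_ge0 a10 b10.
have [badA|] := boolP ((7 * a1 < a0) || (7 * a0 < a1));
  have [badB|] := boolP ((7 * b1 < b0) || (7 * b0 < b1)); rewrite /= ?mul1r ?mul0r.
- lra.
- rewrite negb_or -!leNgt => /andP[_ gb]; have := ler_wpM2l a00 gb; lra.
- rewrite negb_or -!leNgt => /andP[_ ga]; have := ler_wpM2r b00 ga; lra.
- rewrite !negb_or -!leNgt => /andP[gb _] /andP[ga _].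
  have := ler_wpM2r b10 ga; have := ler_wpM2l a10 gb.
  have := ler_wpM2r b00 ga; lra.
Qed.

(** Pair the [D] that differ only at [i]: neither [hits_at] nor [biased] sees the difference, and
    [four_point] applies to each pair. The factor 4 below is 2 for this pairing times 2 from
    [hits_in]; 112 / 4 = 28. *)
Lemma rectangle_planting_at A B i :
  \sum_(D : V) hits A D * hits B (compl D) <=
  28 * (\sum_(D : V) hits_at A D i true * hits_at B (compl D) i true)
  + 9 * (\sum_(D : V) (D i && biased A D i)%:R * (hits A D * hits B (compl D)))
  + 9 * (\sum_(D : V) (compl D i && biased B (compl D) i)%:R * (hits A D * hits B (compl D))).
Proof.
pose a b D := hits_at A D i b; pose a' b D := hits_at B (compl D) i b.
pose f D := hits A D * hits B (compl D).
have At D : D i -> 2 * f D = (a true D + a false D) * a' false D.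
  move=> Di; rewrite /f mulrA (hits_in A Di); congr (_ * _).
  by apply: hits_out; rewrite ffunE Di.
have Af D : ~~ D i -> 2 * f D = a false D * (a' true D + a' false D).
  move=> Di; rewrite /f mulrCA (hits_out A Di) (@hits_in B _ i) //.
  by rewrite ffunE.
have aU b c D : a b (upd D i c) = a b D by exact: hits_at_upd.
have a'U b c D : a' b (upd D i c) = a' b D.
  by rewrite /a' compl_upd hits_at_upd.
have updT D c : upd D i c i = c by rewrite ffunE eqxx.
have S0 : 4 * (\sum_(D : V) f D) =
    \sum_(D : V) ((a true D + a false D) * a' false D + a false D * (a' true D + a' false D)).
  rewrite (natrM _ 2 2) -mulrA -(sum_upd_bool _ i) mulr_sumr.
  apply: eq_bigr => D _; rewrite mulrDr At ?updT // Af ?updT //.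
  by rewrite !aU !a'U.
have SA : 4 * (\sum_(D : V) (D i && biased A D i)%:R * f D) =
    \sum_(D : V) (biased A D i)%:R * ((a true D + a false D) * a' false D).
  rewrite (natrM _ 2 2) -mulrA -(sum_upd_bool _ i) mulr_sumr.
  apply: eq_bigr => D _; rewrite !updT /= mul0r addr0 mulrCA At ?updT //.
  by rewrite !aU !a'U biased_upd.
have SB : 4 * (\sum_(D : V) (compl D i && biased B (compl D) i)%:R * f D) =
    \sum_(D : V) (biased B (compl D) i)%:R * (a false D * (a' true D + a' false D)).
  rewrite (natrM _ 2 2) -mulrA -(sum_upd_bool _ i) mulr_sumr.
  apply: eq_bigr => D _; rewrite !compl_upd !updT /= mul0r add0r mulrCA.
  by rewrite Af ?updT // !aU !a'U biased_upd.
have : \sum_(D : V) ((a true D + a false D) * a' false D + a false D * (a' true D + a' false D))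
   <= \sum_(D : V) (112 * (a true D * a' true D)
       + 9 * ((biased A D i)%:R * ((a true D + a false D) * a' false D))
       + 9 * ((biased B (compl D) i)%:R * (a false D * (a' true D + a' false D)))).
  by apply: ler_sum => D _; apply: four_point => //; apply: hits_at_ge0.
rewrite !big_split /= -!mulr_sumr -big_split /= -S0 -SA -SB /f /a /a'.
set s0 := \sum_(D : V) _; set s1 := \sum_(D : V) _; set s2 := \sum_(D : V) _; set s3 := \sum_(D : V) _.
lra.
Qed.

(** After summing over [i], each of the two bias terms costs at most 9/36 of the left side plus an
    error, by [sum_biased_hits]. Together they absorb half of the left side; doubling turns 28 into
    56. *)
Lemma rectangle_planting A B :
  #|T|%:R * (\sum_(D : V) hits A D * hits B (compl D)) <=
  56 * (\sum_i \sum_(D : V) hits_at A D i true * hits_at B (compl D) i true)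
  + 72 * (9 / 10) ^+ (#|T| %/ 36) * (#|T|%:R * 8 ^+ #|T|).
Proof.
pose f D := hits A D * hits B (compl D).
set e := 72 * _; set m := #|T|%:R; set M : R := 2 ^+ #|T|.
have m0 : 0 <= m by rewrite ler0n.
have e0 : 0 <= e by rewrite mulr_ge0 // exprn_ge0 //; lra.
have M0 : 0 <= M by rewrite exprn_ge0.
have sumM : \sum_(D : V) M * M = M * M * M :> R.
  by rewrite sumr_const card_ffun card_bool -mulr_natl natrX mulrA.
have M8 : (8 : R) ^+ #|T| = M * M * M by rewrite -!exprMn -!natrM.
(* One statement for both players: [g] is the identity for Alice and the complement for Bob. *)
have part (C : pred V) (g : V -> V) (h : V -> R) :
    (forall D, f D = hits C (g D) * h D) -> (forall D, 0 <= h D <= M) ->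
    36 * (\sum_(D : V) (\sum_i (g D i && biased C (g D) i)%:R) * f D)
    <= m * (\sum_(D : V) f D) + e * m * (M * M * M).
  move=> fE hM; rewrite -sumM !mulr_sumr -big_split /=; apply: ler_sum => D _.
  have /andP[h0 h1] := hM D; rewrite fE.
  have := ler_wpM2r h0 (sum_biased_hits C (g D)); rewrite -/m -/e -/M.
  have := ler_wpM2l (mulr_ge0 (mulr_ge0 e0 m0) M0) h1.
  set s := \sum_i _; set y := hits _ _; lra.
have bnd C D : 0 <= hits C D <= M by rewrite hits_ge0 hits_le.
have pA := part A id (fun D => hits B (compl D)) (fun=> erefl) (fun D => bnd _ _).
have pB := part B (@compl T) (fun D => hits A D) (fun=> mulrC _ _) (fun D => bnd _ _).
have tot : \sum_(i : T) \sum_(D : V) f D <=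
  \sum_i (28 * (\sum_(D : V) hits_at A D i true * hits_at B (compl D) i true)
  + 9 * (\sum_(D : V) (D i && biased A D i)%:R * f D)
  + 9 * (\sum_(D : V) (compl D i && biased B (compl D) i)%:R * f D)).
  by apply: ler_sum => i _; apply: rectangle_planting_at.
move: tot; rewrite !big_split /= -!mulr_sumr sumr_const -mulr_natl.
rewrite [\sum_i \sum_(D : V) (_ && biased A _ _)%:R * _]exchange_big /=.
rewrite [\sum_i \sum_(D : V) (_ && biased B _ _)%:R * _]exchange_big /=.
under [X in _ + 9 * X + _]eq_bigr => D _ do rewrite -mulr_suml.
under [X in _ + 9 * X]eq_bigr => D _ do rewrite -mulr_suml.
move: pA pB; rewrite M8 -/m /=.
set s0 := \sum_(D : V) f D; set s1 := \sum_(D : V) _ * f D.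
set s2 := \sum_(D : V) _ * f D; set s3 := \sum_i _; lra.
Qed.

End Razborov.

(** * Direct product *)

Section HardDistribution.
Variables (R : realFieldType) (T : finType).
Notation V := {ffun T -> bool}.

(* [(i, D, u, v)]: Alice's and Bob's sets are [u] inside [D] and [v] outside [D];
   for an intersecting instance both players also get the element [i]. *)
Notation seed := (T * V * V * V)%type.

Definition seedA (b : bool) (w : seed) : V :=
  let: (i, D, u, v) := w in if b then restrict u D else upd (restrict u D) i true.

Definition seedB (b : bool) (w : seed) : V :=
  let: (i, D, u, v) := w in
  if b then restrict v (compl D) else upd (restrict v (compl D)) i true.

Lemma seed_disjoint b w : [forall i, ~~ (seedA b w i && seedB b w i)] = b.
Proof.
case: w => [[[i D] u] v]; case: b; last first.
  by apply/negP => /forallP /(_ i); rewrite !ffunE eqxx.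
by apply/forallP => j; rewrite !ffunE; case: (D j); rewrite /= ?andbF.
Qed.

Lemma sum_seed (F : seed -> R) :
  \sum_w F w = \sum_(i : T) \sum_(D : V) \sum_(u : V) \sum_(v : V) F (i, D, u, v).
Proof. by rewrite !pair_bigA /=; apply: eq_bigr => -[[[i D] u] v]. Qed.

Lemma sum_rectangle (A B : pred V) (f g : V -> V) :
  \sum_(u : V) \sum_(v : V) (A (f u) && B (g v))%:R =
  (\sum_u (A (f u))%:R) * (\sum_v (B (g v))%:R) :> R.
Proof.
rewrite mulr_suml; apply: eq_bigr => u _; rewrite mulr_sumr.
by apply: eq_bigr => v _; rewrite -natrM mulnb.
Qed.

Lemma seed_rectangle (A B : pred V) :
  \sum_w (A (seedA true w) && B (seedB true w))%:R <=
  56 * (\sum_w (A (seedA false w) && B (seedB false w))%:R)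
  + 72 * (9 / 10) ^+ (#|T| %/ 36) * #|{: seed}|%:R :> R.
Proof.
have -> : #|{: seed}|%:R = #|T|%:R * 8 ^+ #|T| :> R.
  rewrite !card_prod card_ffun card_bool -!mulnA -!expnMn.
  by rewrite natrM natrX.
rewrite !sum_seed /=.
under eq_bigr => i _ do under eq_bigr => D _ do rewrite sum_rectangle.
under [X in 56 * X]eq_bigr => i _ do under eq_bigr => D _ do rewrite sum_rectangle.
by rewrite sumr_const -[X in X <= _]mulr_natl; apply: rectangle_planting.
Qed.

End HardDistribution.

Definition instances (J W V : finType) (X : bool -> W -> V)
    (z : {ffun J -> bool}) (w : {ffun J -> W}) : {ffun J -> V} :=
  [ffun j => X (z j) (w j)].

Section DirectProduct.
Variables (R : realFieldType) (J W V : finType) (X Y : bool -> W -> V).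
Variables (e : R).
Hypothesis e_ge0 : 0 <= e.
Hypothesis W_gt0 : (0 < #|W|)%N.
Hypothesis XY_rect : forall A B : pred V,
  \sum_w (A (X true w) && B (Y true w))%:R <=
  56 * (\sum_w (A (X false w) && B (Y false w))%:R) + e * #|W|%:R :> R.

Notation Z := {ffun J -> bool}.
Notation WJ := {ffun J -> W}.

Notation prodX := (instances X).
Notation prodY := (instances Y).

Definition mass (A B : pred {ffun J -> V}) (z : Z) : R :=
  \sum_w (A (prodX z w) && B (prodY z w))%:R.

Lemma mass_ge0 A B z : 0 <= mass A B z.
Proof. exact: sumr_ge0. Qed.

(** Fix the seeds of the other instances and average over that of [j]: a section of a rectangle is a
    rectangle, so [XY_rect] applies. *)
Lemma mass_flip A B (z : Z) j :
  z j -> mass A B z <= 56 * mass A B (upd z j false) + e * #|{: WJ}|%:R.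
Proof.
move=> zj; have W0 : 0 < #|W|%:R :> R by rewrite ltr0n.
have avg z' : mass A B z' * #|W|%:R =
    \sum_w \sum_a (A (prodX z' (upd w j a)) && B (prodY z' (upd w j a)))%:R.
  by rewrite (sum_upd (fun w => (A (prodX z' w) && B (prodY z' w))%:R)) mulr_natr.
have prodXE z' w a : prodX (upd z j z') (upd w j a) = upd (prodX z w) j (X z' a).
  by apply/ffunP => i; rewrite !ffunE; case: eqP.
have prodYE z' w a : prodY (upd z j z') (upd w j a) = upd (prodY z w) j (Y z' a).
  by apply/ffunP => i; rewrite !ffunE; case: eqP.
rewrite -(ler_pM2r W0) mulrDl -mulrA !avg.
have -> : e * #|{: WJ}|%:R * #|W|%:R = \sum_(w : WJ) e * #|W|%:R.
  by rewrite sumr_const -mulr_natl; ring.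
rewrite mulr_sumr -big_split /=; apply: ler_sum => w _.
rewrite -{1 2}(upd_id z j) zj.
under eq_bigr => a _ do rewrite prodXE prodYE.
under [X in 56 * X]eq_bigr => a _ do rewrite prodXE prodYE.
exact: (XY_rect (fun v => A (upd (prodX z w) j v)) (fun v => B (upd (prodY z w) j v))).
Qed.

(* Flipping any subset of the positions in [l] keeps a constant share of the
   mass per position, so the flips of [z] together outweigh [z]. *)
Lemma mass_flips A B (l : seq J) (z : Z) :
  uniq l -> (forall j, j \in l -> z j) ->
  (57 / 56) ^+ size l * (mass A B z + e * #|{: WJ}|%:R) <=
  \sum_(z' : Z | [forall j, (j \in l) || (z' j == z j)]) mass A B z'
  + 2 ^+ size l * (e * #|{: WJ}|%:R).
Proof.
set E := e * _; have E0 : 0 <= E by rewrite mulr_ge0.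
elim: l z => [|j l IH] z /=.
  move=> _ _; rewrite !expr0 !mul1r lerD2r (bigD1 z) /=; last first.
    by apply/forallP => j; rewrite eqxx.
  by rewrite lerDl sumr_ge0 // => z' _; apply: mass_ge0.
move=> /andP[jl ul] zl; have zj : z j by apply: zl; rewrite inE eqxx.
pose y := upd z j false.
have IHz := IH z ul (fun i il => zl i (mem_behead (s := j :: l) il)).
have IHy : forall i, i \in l -> y i.
  move=> i il; rewrite ffunE; case: eqP => [ij|_]; first by rewrite -ij il in jl.
  by apply: zl; rewrite inE il orbT.
have {}IHy := IH y ul IHy; have flip := mass_flip A B zj.
have r0 : 0 <= (57 / 56 : R) ^+ size l by apply: exprn_ge0; lra.
(* With [E] added to each mass the bound is purely multiplicative: the flip keeps a 1/56 share of
   [mass A B z + E], and the induction can iterate. *)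
have step : 57 / 56 * (mass A B z + E) <= (mass A B z + E) + (mass A B y + E).
  by move: flip; rewrite -/E -/y; lra.
have := ler_wpM2l r0 step; rewrite mulrDr => {}step.
have split_sum :
    \sum_(z' : Z | [forall i, (i \in l) || (z' i == z i)]) mass A B z' +
    \sum_(z' : Z | [forall i, (i \in l) || (z' i == y i)]) mass A B z' <=
    \sum_(z' : Z | [forall i, (i \in j :: l) || (z' i == z i)]) mass A B z'.
  rewrite big_mkcond [X in _ + X <= _]big_mkcond [X in _ <= X]big_mkcond /=.
  rewrite -big_split /=; apply: ler_sum => z' _; have m0 := mass_ge0 A B z'.
  case: ifPn => [/forallP h1|n1]; case: ifPn => [/forallP h2|n2].
  - have := h1 j; have := h2 j; rewrite (negbTE jl) /= => /eqP -> /eqP.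
    by rewrite ffunE eqxx zj.
  - rewrite addr0; case: ifPn => // /forallP n3; case: n3 => i.
    rewrite inE; have := h1 i; by case: (i \in l) => [|/= ->]; rewrite ?orbT.
  - rewrite add0r; case: ifPn => // /forallP n3; case: n3 => i.
    rewrite inE; have := h2 i; rewrite ffunE; by case: (i == j).
  - by rewrite addr0; case: ifP.
by rewrite !exprS; lra.
Qed.

Definition nones (z : Z) : nat := #|[set j | z j]|.

(** [mass_flips] at all positions where [z] claims disjointness: up to the error, a rectangle
    answering [z] is right on at most a (56/57)^(nones z) share of its mass. *)
Lemma mass_le A B z :
  (57 / 56) ^+ nones z * mass A B z <=
  \sum_z' mass A B z' + 2 ^+ #|J| * (e * #|{: WJ}|%:R).
Proof.
set E := e * _; have E0 : 0 <= E by rewrite mulr_ge0.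
have := @mass_flips A B (enum [set j | z j]) z (enum_uniq _).
rewrite -cardE -/(nones z) -/E => flips.
have {flips} := flips _; have h j : j \in enum [set j | z j] -> z j.
  by rewrite mem_enum inE.
move=> /(_ h) flips.
have le2 : 2 ^+ nones z * E <= 2 ^+ #|J| * E.
  by apply: ler_wpM2r => //; apply: ler_weXn2l; rewrite ?ler1n // max_card.
have le1 : \sum_(z' : Z | [forall j, (j \in enum [set j | z j]) || (z' j == z j)])
    mass A B z' <= \sum_z' mass A B z'.
  rewrite [X in _ <= X](bigID (fun z' : Z =>
    [forall j, (j \in enum [set j | z j]) || (z' j == z j)])) /=.
  by rewrite lerDl sumr_ge0 // => z' _; apply: mass_ge0.
have : 0 <= (57 / 56) ^+ nones z * E.
  by apply: mulr_ge0 => //; apply: exprn_ge0; lra.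
move: flips; rewrite mulrDr; lra.
Qed.

(* [tr] is the transcript of a protocol and [lab] its answers. *)
Variables (Tr : finType) (tr : {ffun J -> V} -> {ffun J -> V} -> Tr) (lab : Tr -> Z).
Hypothesis tr_rect : forall x x' y y', tr x y = tr x' y' -> tr x y' = tr x y.


Lemma transcript_rectangle t x y :
  (tr x y == t) = [exists y', tr x y' == t] && [exists x', tr x' y == t].
Proof.
apply/idP/andP => [/eqP <-|[/existsP[y' /eqP h1] /existsP[x' /eqP h2]]].
  by split; apply/existsP; [exists y|exists x].
by rewrite (@tr_rect x x' y' y) ?h1 ?h2.
Qed.

(** Answers with fewer than [q] ones are counted outright. For the others [mass_le] bounds the
    correct part of each transcript's rectangle; the rectangles partition the inputs, so their
    masses add up to the total, and only the error is multiplied by |Tr|. *)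
Lemma protocol_success q :
  (57 / 56) ^+ q *
    (\sum_z \sum_w (lab (tr (prodX z w) (prodY z w)) == z)%:R) <=
  (57 / 56) ^+ q * (#|[set z | (nones z < q)%N]|%:R * #|{: WJ}|%:R)
  + (1 + #|Tr|%:R * e) * (2 ^+ #|J| * #|{: WJ}|%:R).
Proof.
set r : R := 57 / 56; have r1 : 1 <= r by rewrite /r; lra.
have rq0 n : 0 <= r ^+ n by apply: exprn_ge0; lra.
pose A t : pred {ffun J -> V} := fun x => [exists y, tr x y == t].
pose B t : pred {ffun J -> V} := fun y => [exists x, tr x y == t].
have trE t z w : (tr (prodX z w) (prodY z w) == t) = A t (prodX z w) && B t (prodY z w).
  exact: transcript_rectangle.
have pointwise (z : Z) (w : WJ) :
    (lab (tr (prodX z w) (prodY z w)) == z)%:R <=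
    (nones z < q)%N%:R + \sum_(t | (q <= nones (lab t))%N && (lab t == z))
      (A t (prodX z w) && B t (prodY z w))%:R :> R.
  have [lt|ge] := ltnP.
    apply: (@le_trans _ _ 1); first by rewrite (ler_nat _ _ 1) leq_b1.
    by rewrite lerDl sumr_ge0.
  rewrite add0r; set t0 := tr _ _; have [labt|_] := eqVneq; last exact: sumr_ge0.
  rewrite (bigD1 t0) /= ?labt ?ge ?eqxx //= -trE eqxx lerDl sumr_ge0 //.
have summed : \sum_z \sum_w (lab (tr (prodX z w) (prodY z w)) == z)%:R <=
    #|[set z | (nones z < q)%N]|%:R * #|{: WJ}|%:R
    + \sum_(t | (q <= nones (lab t))%N) mass (A t) (B t) (lab t) :> R.
  apply: (@le_trans _ _ (\sum_z \sum_w ((nones z < q)%N%:R +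
     \sum_(t | (q <= nones (lab t))%N && (lab t == z))
      (A t (prodX z w) && B t (prodY z w))%:R))).
    by apply: ler_sum => z _; apply: ler_sum => w _; apply: pointwise.
  under eq_bigr => z _ do rewrite big_split /= sumr_const.
  rewrite big_split /= lerD //.
    rewrite -sum1dep_card natr_sum big_distrl [X in _ <= X]big_mkcond /=.
    by apply: ler_sum => z _; case: ifP; rewrite ?mul0rn ?mul1r.
  rewrite (partition_big lab predT) //=; apply: ler_sum => z _.
  rewrite exchange_big /=; apply: ler_sum => t /andP[_ /eqP <-].
  by [].
have big_labels : r ^+ q * (\sum_(t | (q <= nones (lab t))%N) mass (A t) (B t) (lab t))
    <= (1 + #|Tr|%:R * e) * (2 ^+ #|J| * #|{: WJ}|%:R).
  rewrite mulr_sumr.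
  apply: (@le_trans _ _ (\sum_t (\sum_z mass (A t) (B t) z
                                 + 2 ^+ #|J| * (e * #|{: WJ}|%:R)))).
    rewrite big_mkcond /=; apply: ler_sum => t _; case: ifPn => [le|_].
      apply: le_trans (mass_le _ _ _); apply: ler_wpM2r; first exact: mass_ge0.
      exact: ler_weXn2l.
    rewrite addr_ge0 ?sumr_ge0 ?mulr_ge0 ?exprn_ge0 // => z _; exact: mass_ge0.
  rewrite big_split /= sumr_const exchange_big /=.
  have -> : \sum_z \sum_t mass (A t) (B t) z = 2 ^+ #|J| * #|{: WJ}|%:R.
    transitivity (\sum_(z : Z) #|{: WJ}|%:R : R); last first.
      by rewrite sumr_const -[LHS]mulr_natl (card_ffun J bool) card_bool natrX.
    apply: eq_bigr => z _; rewrite exchange_big /= -sum1_card natr_sum.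
    apply: eq_bigr => w _; rewrite (bigD1 (tr (prodX z w) (prodY z w))) //=.
    rewrite -trE eqxx big1 ?addr0 // => t.
    by rewrite -trE eq_sym => /negbTE ->.
  rewrite -[X in _ + X]mulr_natl mulrDl mul1r lerD2l.
  by rewrite le_eqVlt; apply/orP; left; apply/eqP; ring.
have := ler_wpM2l (rq0 q) summed; rewrite mulrDr => le.
by apply: le_trans le _; rewrite lerD2l.
Qed.

End DirectProduct.

(** * Numerical estimates and disjointness on blocks *)

Lemma bernoulli (R : realFieldType) (x : R) n : 0 <= x -> 1 + n%:R * x <= (1 + x) ^+ n.
Proof.
move=> x0; elim: n => [|n IH]; first by rewrite mul0r addr0 expr0.
rewrite exprS -natr1; apply: le_trans (ler_wpM2l _ IH); last lra.
have : 0 <= n%:R * x * x by rewrite !mulr_ge0.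
lra.
Qed.

Lemma pow_57_56 (R : realFieldType) n : 2 ^+ n <= (57 / 56 : R) ^+ (56 * n).
Proof.
rewrite exprM; apply: lerXn2r; rewrite ?nnegrE //; first by apply: exprn_ge0; lra.
have -> : 57 / 56 = 1 + 56^-1 :> R by lra.
apply: le_trans (bernoulli _ _); first by rewrite divff ?pnatr_eq0.
by rewrite invr_ge0.
Qed.

Lemma pow_9_10 (R : realFieldType) n k :
  (7 * n <= k)%N -> 2 ^+ n * (9 / 10 : R) ^+ k <= 1.
Proof.
move=> le; apply: (@le_trans _ _ (2 ^+ n * (9 / 10) ^+ (7 * n))).
  by apply: ler_wpM2l; [exact: exprn_ge0 | apply: ler_wiXn2l le; lra].
rewrite exprM -exprMn exprn_ile1 //.
  by apply: mulr_ge0 => //; apply: exprn_ge0; lra.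
by rewrite !exprS expr0; lra.
Qed.

Section Blocks.
Variables (R : realFieldType) (k m : nat).
Notation V := {ffun 'I_m -> bool}.
Notation seed := ('I_m * V * V * V)%type.
Notation WJ := {ffun 'I_k -> seed}.
Notation Z := {ffun 'I_k -> bool}.

(** [protocol_success] with [q = 56 * s], a quarter of [k]: (57/56)^q is at least 2^s, and a random
    [z] has fewer than [q] ones with probability at most 2^(-s). The 3 is 1 for these [z] plus 2 for
    the rest. *)
Lemma disjointness_success (s c : nat)
    (tr : {ffun 'I_k -> V} -> {ffun 'I_k -> V} -> c.-tuple bool)
    (lab : c.-tuple bool -> Z) :
  (0 < m)%N -> (k = 4 * (56 * s))%N -> (36 * (7 * (c + 7)) <= m)%N ->
  (forall x x' y y', tr x y = tr x' y' -> tr x y' = tr x y) ->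
  2 ^+ s * (\sum_(z : Z) \sum_(w : WJ)
    (lab (tr (instances (@seedA _) z w) (instances (@seedB _) z w)) == z)%:R)
  <= 3 * (2 ^+ k * #|{: WJ}|%:R) :> R.
Proof.
move=> m0 kE cm tr_rect.
pose e : R := 72 * (9 / 10) ^+ (m %/ 36).
have e0 : 0 <= e by apply: mulr_ge0 => //; apply: exprn_ge0; lra.
have W0 : (0 < #|{: seed}|)%N.
  by rewrite !card_prod !card_ffun card_bool !card_ord !muln_gt0 !expn_gt0 m0.
have rect (A B : pred V) :
  \sum_w (A (seedA true w) && B (seedB true w))%:R <=
  56 * (\sum_w (A (seedA false w) && B (seedB false w))%:R) + e * #|{: seed}|%:R :> R.
  by have := @seed_rectangle R 'I_m A B; rewrite [#|'I_m|]card_ord.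
have := protocol_success e0 W0 rect lab tr_rect (56 * s).
set succ := \sum_z _; rewrite card_tuple card_bool natrX card_ord.
set r : R := (57 / 56) ^+ _; set wj : R := #|{: WJ}|%:R.
set few := #|_| => main.
have wj0 : 0 <= wj by rewrite ler0n.
(* The 7 in [c + 7] pays for the constant of [e], as 72 < 2^7. *)
have Tr1 : 2 ^+ c * e <= 1.
  have le := @pow_9_10 R (c + 7) (m %/ 36).
  have {le} : 2 ^+ (c + 7) * (9 / 10) ^+ (m %/ 36) <= 1 :> R by apply: le; lia.
  rewrite exprD /e; have : 0 <= 2 ^+ c * (9 / 10) ^+ (m %/ 36) :> R.
    by apply: mulr_ge0; apply: exprn_ge0; lra.
  rewrite !exprS expr0; set u := 2 ^+ c; set v := _ ^+ (m %/ 36); lra.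
have rs : 2 ^+ s <= r by exact: pow_57_56.
have N0 : 0 <= (2 : R) ^+ s by apply: exprn_ge0.
have fewN : 2 ^+ s * few%:R <= 2 ^+ k :> R.
  (* Few ones means few agreements with the constant [true]. *)
  have := @card_few_agreements 'I_k [set: 'I_k] (fun=> true).
  rewrite cardsT card_ord; set few' := #|_|.
  have few_le : (few <= few')%N.
    apply: subset_leq_card; apply/subsetP => z; rewrite !inE => lt.
    rewrite [leqRHS]kE leq_mul2l /=; apply: leq_trans (ltnW lt).
    by apply: subset_leq_card; apply/subsetP => i; rewrite !inE => /eqP ->.
  move=> few108; have {few108} : few'%:R <= 2 ^+ k * (97 / 108) ^+ k :> R.
    rewrite expr_div_n mulrA ler_pdivlMr ?exprn_gt0 //.
    by rewrite -!natrX -!natrM ler_nat.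
  have pow : (97 / 108 : R) ^+ k <= (9 / 10) ^+ k.
    by apply: lerXn2r; rewrite ?nnegrE; lra.
  have half : 2 ^+ s * (9 / 10) ^+ k <= 1 :> R by apply: pow_9_10; lia.
  have f' : few%:R <= few'%:R :> R by rewrite ler_nat.
  move=> /(le_trans f') {}f'.
  have k0 : 0 <= (2 : R) ^+ k by apply: exprn_ge0.
  apply: le_trans (ler_wpM2l N0 (le_trans f' (ler_wpM2l k0 pow))) _.
  by rewrite mulrCA -[X in _ <= X]mulr1; apply: ler_wpM2l.
have r0 : 0 <= r := le_trans N0 rs.
have main' : r * (succ - few%:R * wj) <= 2 * (2 ^+ k * wj).
  have : (1 + 2 ^+ c * e) * (2 ^+ k * wj) <= 2 * (2 ^+ k * wj).
    by apply: ler_wpM2r; rewrite ?mulr_ge0 ?exprn_ge0 //; lra.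
  by move: main; rewrite mulrBr; lra.
(* [r] may be lowered to 2^s only against a nonnegative factor; otherwise the bound is trivial. *)
have main2 : 2 ^+ s * (succ - few%:R * wj) <= 2 * (2 ^+ k * wj).
  have [ge|lt] := leP 0 (succ - few%:R * wj).
    exact: le_trans (ler_wpM2r ge rs) main'.
  apply: (@le_trans _ _ 0); first by rewrite mulr_ge0_le0 // ltW.
  by rewrite !mulr_ge0 ?exprn_ge0.
have := ler_wpM2r wj0 fewN; move: main2; rewrite mulrBr mulrA; lra.
Qed.

End Blocks.

(** * Circuits as protocols *)

Section Programs.
Variables (l r n : nat).
Implicit Types (P Q : program l r n) (s : state l r).

Fixpoint transcript x y s Q : seq bool :=
  if Q is c :: Q' then
    let t := transcript x y (step x y s c) Q' in
    match c with
    | Send p i => wire p s i :: t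
    | Output p i _ => wire p s i :: t
    | _ => t
    end
  else [::].

Definition output_key (c : instr l r n) : option ('I_l * 'I_r) :=
  if c is Output _ _ k then Some k else None.

Definition output_keys Q : seq ('I_l * 'I_r) := pmap output_key Q.

(** Outputs are sent too, so the transcript alone determines them and the answers are constant on
    each rectangle. *)
Fixpoint read_outputs Q (t : seq bool) : seq (('I_l * 'I_r) * bool) :=
  if Q is c :: Q' then
    match c with
    | Send _ _ => read_outputs Q' (behead t)
    | Output _ _ k => (k, head false t) :: read_outputs Q' (behead t)
    | _ => read_outputs Q' t
    end
  else [::].

Lemma size_transcript x y s Q : size (transcript x y s Q) = comm Q.
Proof.
by elim: Q s => //= c Q IH s; rewrite /comm /= -/(comm Q);
   case: c => *; rewrite /= IH.
Qed.

Lemma outs_run x y s Q :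
  outs (foldl (step x y) s Q) = outs s ++ read_outputs Q (transcript x y s Q).
Proof.
elim: Q s => /= [s|c Q IH s]; first by rewrite cats0.
rewrite IH; case: c => [p f i j|k i|k i|p|p i|p i|p i k] //=;
  try by case: p.
by rewrite cat_rcons; case: p.
Qed.

Lemma keys_read_outputs Q t : [seq o.1 | o <- read_outputs Q t] = output_keys Q.
Proof. by elim: Q t => //= -[p f i j|k i|k i|p|p i|p i|p i k] Q IH t /=; rewrite IH. Qed.

(** The program fixes how many coins are drawn, so a slice starts at the same place of the tape on
    every input. *)
Lemma tape_run x y s Q : tape (foldl (step x y) s Q) = drop (ncoins Q) (tape s).
Proof.
elim: Q s => /= [s|c Q IH s]; first by rewrite drop0.
rewrite IH /ncoins /= -/(ncoins Q).
case: c => [p f i j|k i|k i|p|p i|p i|p i k] //=; try by case: p.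
by case: p => /=; rewrite -drop1 drop_drop addnC.
Qed.

(* A communicating circuit is a two-party protocol: each memory depends only on
   its owner's input, the start and the bits exchanged. *)
Lemma cut_and_paste x x' y y' s1 s2 s3 Q :
  memA s3 = memA s1 -> memB s3 = memB s2 -> tape s1 = tape s2 -> tape s3 = tape s1 ->
  transcript x y s1 Q = transcript x' y' s2 Q ->
  transcript x y' s3 Q = transcript x y s1 Q.
Proof.
elim: Q s1 s2 s3 => //= c Q IH s1 s2 s3 eA eB eT eT'.
have wA i : wire Alice s3 i = wire Alice s1 i by rewrite /wire /= eA.
have wB i : wire Bob s3 i = wire Bob s2 i by rewrite /wire /= eB.
case: c => [p f i j|k i|k i|p|p i|p i|p i k] /=; try case: p => /=.
- by apply: IH => //=; rewrite ?wA ?eA.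
- by apply: IH => //=; rewrite ?wB ?eB.
- by apply: IH => //=; rewrite ?eA.
- by apply: IH => //=; rewrite ?eB.
- by apply: IH => //=; rewrite ?eA ?eT' ?eT.
- by apply: IH => //=; rewrite ?eB ?eT' ?eT.
- by apply: IH => //=; rewrite ?eA.
- by apply: IH => //=; rewrite ?eB.
(* Bob's memory comes from run [s2], yet he receives Alice's bit of run [s1]; equal transcripts make
   the two bits coincide. *)
- case=> w12 /IH h; rewrite wA; congr (_ :: _); apply: h => //=; first by rewrite eA.
  by rewrite eB ?wA w12.
- case=> w12 /IH h; rewrite wB -w12; congr (_ :: _); apply: h => //=; last by rewrite eB.
  by rewrite eA ?wB -?w12.
- case=> w12 /IH h; rewrite wA; congr (_ :: _); apply: h => //=; first by rewrite eA.
  by rewrite eB ?wA w12.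
- case=> w12 /IH h; rewrite wB -w12; congr (_ :: _); apply: h => //=; last by rewrite eB.
  by rewrite eA ?wB -?w12.
Qed.

Lemma space_run x y t P Q S :
  space_bounded (P ++ Q) S ->
  let s := foldl (step x y) (State [::] [::] t [::]) P in
  (size (memA s) + size (memB s) <= S)%N.
Proof.
move=> /(_ x y t); rewrite /trace.
move: (State _ _ _ _) => s0; elim: P s0 => [|c P IH] s0 /=.
  by case/andP.
by case/andP => _ /IH.
Qed.

Lemma correct_outputs (x : 'I_l -> 'I_n -> bool) (y : 'I_r -> 'I_n -> bool) s k b :
  all_outputs_correct x y s -> (k, b) \in outs s -> b = DISJ (x k.1) (y k.2).
Proof.
move=> /forallP /(_ k) /eqP keys kb.
have : b \in [seq o.2 | o <- outs s & o.1 == k].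
  by apply/mapP; exists (k, b) => //; rewrite mem_filter eqxx.
by rewrite keys inE => /eqP.
Qed.

(** The output schedule is independent of inputs and coins, so one correct run, here on the zero
    input, shows that each pair is output exactly once. *)
Lemma computes_keys P :
  computes_DISJ P -> uniq (output_keys P) /\ size (output_keys P) = (l * r)%N.
Proof.
move=> /(_ (fun _ _ => false) (fun _ _ => false)).
set E := [set t | _] => correct.
have /card_gt0P[t] : (0 < #|E|)%N.
  have : (0 < 2 * #|E|)%N by apply: leq_trans correct; rewrite expn_gt0.
  by rewrite muln_gt0.
rewrite inE => /forallP ok.
set s := final _ _ _ _ in ok.
have keysE : [seq o.1 | o <- outs s] = output_keys P.
  by rewrite /s /final outs_run keys_read_outputs.
have cnt k : count_mem k (output_keys P) = 1%N.
  rewrite -keysE count_map -size_filter -(size_map snd).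
  by have /eqP := ok k => /(congr1 size).
have mem k : k \in output_keys P by rewrite -has_pred1 has_count cnt.
have u : uniq (output_keys P) by apply: count_mem_uniq => k; rewrite cnt mem.
split=> //; rewrite -(card_uniqP u) -[l in RHS]card_ord -[r in RHS]card_ord -card_prod.
by apply: eq_card => k; rewrite mem.
Qed.

Lemma size_output_keys Q : (size (output_keys Q) <= comm Q)%N.
Proof.
by elim: Q => //= -[p f i j|k i|k i|p|p i|p i|p i k] Q IH //=; rewrite ltnW.
Qed.

End Programs.

(** * Slices of a circuit *)

Section Embedding.
Variables (l r n k m : nat) (pr : 'I_k -> 'I_l * 'I_r) (phi : 'I_k * 'I_m -> 'I_n).
Hypotheses (pr_inj : injective pr) (phi_inj : injective phi).
Notation V := {ffun 'I_m -> bool}.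

(* Instance [j] lives on its own block [phi (j, _)] of coordinates. *)
Definition embedA (X : {ffun 'I_k -> V}) (i : 'I_l) (p : 'I_n) : bool :=
  [exists f, [&& phi f == p, (pr f.1).1 == i & X f.1 f.2]].

Definition embedB (Y : {ffun 'I_k -> V}) (i : 'I_r) (p : 'I_n) : bool :=
  [exists f, [&& phi f == p, (pr f.1).2 == i & Y f.1 f.2]].

(** An input vector may serve several pairs, but in different blocks. A common element lies in a
    single block, whose pair has both components of [pr j] and hence is [pr j]. *)
Lemma DISJ_embed X Y j :
  DISJ (embedA X (pr j).1) (embedB Y (pr j).2) = [forall i, ~~ (X j i && Y j i)].
Proof.
apply/forallP/forallP => h i.
  apply: contra (h (phi (j, i))) => /andP[xi yi].
  by apply/andP; split; apply/existsP; exists (j, i); rewrite /= !eqxx.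
apply/negP => /andP[/existsP[f /and3P[/eqP fi /eqP f1 xf]]].
move=> /existsP[g /and3P[/eqP gi /eqP g2 yg]].
have gf : g = f by apply: phi_inj; rewrite fi.
subst g; have fj : f.1 = j.
  by apply: pr_inj; rewrite [LHS]surjective_pairing f1 g2 -surjective_pairing.
by have := h f.2; rewrite -fj xf yg.
Qed.

End Embedding.

Lemma exists_block_injection n k m :
  (k * m <= n)%N -> exists phi : 'I_k * 'I_m -> 'I_n, injective phi.
Proof.
move=> le; have le' : (#|{: 'I_k * 'I_m}| <= n)%N by rewrite card_prod !card_ord.
exists (fun f => widen_ord le' (enum_rank f)) => f g fg.
by apply: enum_rank_inj; apply: val_inj; have /(congr1 val) := fg.
Qed.

(* An encoding of all the pairs of memories with at most [S] bits in total. *)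
Definition memories (S : nat) : finType := ('I_S.+1 * 'I_S.+1 * S.-tuple bool)%type.

Definition memories_start (l r S : nat) (t : seq bool) (g : memories S) : state l r :=
  let: (a, b, u) := g in State (take a u) (take b (drop a u)) t [::].

Lemma memories_startP l r S t (mA mB : seq bool) :
  (size mA + size mB <= S)%N ->
  exists g : memories S, memories_start l r t g = State mA mB t [::] :> state l r.
Proof.
move=> le; pose u := mA ++ mB ++ nseq (S - (size mA + size mB)) false.
have su : size u == S by rewrite !size_cat size_nseq; lia.
have lA : (size mA < S.+1)%N by lia.
have lB : (size mB < S.+1)%N by lia.
exists (Ordinal lA, Ordinal lB, Tuple su) => /=.
by rewrite take_size_cat // drop_size_cat // take_size_cat.
Qed.

Lemma card_memories S : (#|{: memories S}| <= 2 ^ (3 * S))%N.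
Proof.
rewrite !card_prod !card_ord card_tuple card_bool.
have : (S < 2 ^ S)%N by apply: ltn_expl.
have -> : (3 * S = S + S + S)%N by lia.
by rewrite !expnD => lt; rewrite leq_mul // leq_mul.
Qed.

Section Segment.
Variables (l r n S m : nat) (P1 Q P2 : program l r n).
Hypotheses (S_gt0 : (0 < S)%N) (m_gt0 : (0 < m)%N).
Hypothesis computes : computes_DISJ (P1 ++ Q ++ P2).
Hypothesis space : space_bounded (P1 ++ Q ++ P2) S.
Hypothesis comm_small : (36 * (7 * (comm Q + 7)) <= m)%N.
Let k := (4 * (56 * (7 * S)))%N.
Hypothesis room : (k * m <= n)%N.

(** With [k] outputs, each possible memory content at the start succeeds on at most a 3 * 2^(-7S)
    share of the hard inputs. A union bound over the at most 2^(3S) contents leaves at most 3/16,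
    less than the required 1/2. *)
Lemma segment_outputs : (size (output_keys Q) < k)%N.
Proof.
rewrite ltnNge; apply/negP => many.
have [uniqP _] := computes_keys computes.
have uniqQ : uniq (output_keys Q).
  by move: uniqP; rewrite /output_keys !pmap_cat !cat_uniq => /and3P[_ _ /andP[]].
have [phi phi_inj] := exists_block_injection room.
have k_gt0 : (0 < k)%N by rewrite /k; lia.
have [d _] : exists d, d \in output_keys Q.
  case: (output_keys Q) many => [|d q _]; first by rewrite leqNgt k_gt0.
  by exists d; rewrite inE eqxx.
pose pr (j : 'I_k) := nth d (output_keys Q) j.
have pr_lt (j : 'I_k) : (j < size (output_keys Q))%N.
  exact: leq_trans (ltn_ord j) many.
have pr_inj : injective pr.
  by move=> i j /eqP; rewrite nth_uniq // => /eqP /val_inj.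
pose P := P1 ++ Q ++ P2.
pose V := {ffun 'I_m -> bool}.
pose W := {ffun 'I_k -> 'I_m * V * V * V}.
pose Z := {ffun 'I_k -> bool}.
pose xin (X : {ffun 'I_k -> V}) := embedA pr phi X.
pose yin (Y : {ffun 'I_k -> V}) := embedB pr phi Y.
pose XX (z : Z) (w : W) := instances (@seedA _) z w.
pose YY (z : Z) (w : W) := instances (@seedB _) z w.
pose good (z : Z) (w : W) (t : (ncoins P).-tuple bool) :=
  all_outputs_correct (xin (XX z w)) (yin (YY z w))
    (final (xin (XX z w)) (yin (YY z w)) P t).
pose lab (u : (comm Q).-tuple bool) : Z :=
  [ffun j : 'I_k => (nth (d, false) (read_outputs Q u) j).2].
pose st t g := memories_start l r (S := S) (drop (ncoins P1) t) g.
have sz X Y s : size (transcript (xin X) (yin Y) s Q) == comm Q.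
  by apply/eqP; apply: size_transcript.
pose tr t g X Y := Tuple (sz X Y (st t g)).
have rect t g x x' y y' : tr t g x y = tr t g x' y' -> tr t g x y' = tr t g x y.
  move=> /(congr1 val) /= e; apply: val_inj => /=.
  exact: (cut_and_paste (s1 := st t g) (s2 := st t g) (s3 := st t g)) e.
pose hit t g (z : Z) (w : W) := lab (tr t g (XX z w) (YY z w)) == z.
have good_hit z w t : good z w t -> [exists g, hit t g z w].
  move=> ok.
  have := space_run (xin (XX z w)) (yin (YY z w)) t space.
  set s0 := foldl _ _ _ => /= small.
  have [g gE] := memories_startP l r (drop (ncoins P1) t) small.
  (* [s0] may already hold outputs, unlike [st t g]; [cut_and_paste] with equal inputs shows that
     the transcript ignores them. *)
  have trE : transcript (xin (XX z w)) (yin (YY z w)) s0 Q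
      = transcript (xin (XX z w)) (yin (YY z w)) (st t g) Q.
    have s0t : tape s0 = drop (ncoins P1) t by rewrite /s0 tape_run.
    by apply: (@cut_and_paste _ _ _ _ (xin (XX z w)) _ _ _ (st t g));
      rewrite // /st gE ?s0t.
  apply/existsP; exists g; apply/eqP/ffunP => j; rewrite ffunE.
  have keys u : [seq o.1 | o <- read_outputs Q u] = output_keys Q.
    exact: keys_read_outputs.
  have := mem_nth (d, false) (s := read_outputs Q (tr t g (XX z w) (YY z w))) (n := j).
  rewrite -(size_map fst) keys => /(_ (pr_lt j)).
  set o := nth _ _ _ => oin.
  have o1 : o.1 = pr j.
    by rewrite /o -(nth_map _ d fst) ?keys // -(size_map fst) keys.
  have out_in : (o.1, o.2) \in outs (final (xin (XX z w)) (yin (YY z w)) P t).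
    rewrite -surjective_pairing /final /P !foldl_cat outs_run mem_cat outs_run mem_cat.
    by rewrite -/s0 trE oin orbT.
  rewrite (correct_outputs ok out_in) o1 (DISJ_embed pr_inj phi_inj).
  by rewrite !ffunE seed_disjoint.
pose tot : rat := 2 ^+ k * #|{: W}|%:R.
have tot0 : 0 < tot.
  rewrite mulr_gt0 ?exprn_gt0 // ltr0n card_ffun expn_gt0; apply/orP; left.
  by rewrite !card_prod !card_ffun card_bool !card_ord !muln_gt0 !expn_gt0 m_gt0.
have per_start t g : 2 ^+ (7 * S) * (\sum_z \sum_w (hit t g z w)%:R) <= 3 * tot.
  exact: (disjointness_success rat lab m_gt0 (erefl k) comm_small (rect t g)).
have per_coins t : 16 * (\sum_z \sum_w (good z w t)%:R) <= 3 * tot.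
  have le : \sum_z \sum_w (good z w t)%:R <=
      \sum_g \sum_z \sum_w (hit t g z w)%:R :> rat.
    rewrite [leRHS]exchange_big; apply: ler_sum => z _.
    rewrite [leRHS]exchange_big; apply: ler_sum => w _.
    case: (boolP (good z w t)) => [/good_hit /existsP[g hg]|_]; last exact: sumr_ge0.
    by rewrite (bigD1 g) //= hg lerDl sumr_ge0.
  have le2 : 2 ^+ (7 * S) * (\sum_g \sum_z \sum_w (hit t g z w)%:R) <=
      2 ^+ (3 * S) * (3 * tot).
    rewrite mulr_sumr; apply: (@le_trans _ _ (\sum_(g : memories S) 3 * tot)).
      by apply: ler_sum => g _; apply: per_start.
    rewrite sumr_const -[leLHS]mulr_natl; apply: ler_wpM2r; first by lra.
    by rewrite -natrX ler_nat card_memories.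
  (* Of the gain 2^(7S) the union bound leaves 2^(4S), at least 16 since [S] is positive. *)
  have -> : 16 = 2 ^+ 4 :> rat by rewrite -natrX.
  have e0 : 0 < (2 : rat) ^+ (3 * S) by apply: exprn_gt0.
  rewrite -(ler_pM2l e0); apply: le_trans le2; rewrite mulrA -exprD.
  apply: ler_pM => //; rewrite ?exprn_ge0 //.
    by apply: sumr_ge0 => z _; apply: sumr_ge0.
  by apply: ler_weXn2l; [lra | lia].
have many_good z w : 2 ^+ ncoins P <= 2 * (\sum_t (good z w t)%:R) :> rat.
  have := computes (xin (XX z w)) (yin (YY z w)).
  rewrite -(ler_nat rat) natrX natrM -sum1dep_card natr_sum big_mkcond /=.
  by move=> le; apply: le_trans le _; apply: ler_wpM2l => //; apply: ler_sum => t _;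
     rewrite /good; case: ifP.
have upper : 16 * (\sum_t \sum_z \sum_w (good z w t)%:R) <= 2 ^+ ncoins P * (3 * tot).
  rewrite mulr_sumr; apply: (@le_trans _ _ (\sum_(t : (ncoins P).-tuple bool) 3 * tot)).
    by apply: ler_sum => t _; apply: per_coins.
  by rewrite sumr_const card_tuple card_bool -[X in X <= _]mulr_natl natrX.
have lower : 2 ^+ ncoins P * tot <= 2 * (\sum_t \sum_z \sum_w (good z w t)%:R).
  rewrite exchange_big mulr_sumr /=.
  apply: (@le_trans _ _ (\sum_(z : Z) \sum_(w : W) 2 ^+ ncoins P)).
    rewrite !sumr_const -!mulrnA -[X in _ <= X]mulr_natr natrM /tot.
    by rewrite (card_ffun 'I_k bool) card_bool card_ord natrX [_ * 2 ^+ k]mulrC.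
  apply: ler_sum => z _; rewrite exchange_big mulr_sumr /=.
  by apply: ler_sum => w _; apply: many_good.
(* [lower] makes [16 * sg] at least [8 * (p * tot)], [upper] at most [3 * (p * tot)]. *)
have c0 : 0 < (2 : rat) ^+ ncoins P by apply: exprn_gt0.
have := mulr_gt0 c0 tot0; move: upper lower.
set sg := \sum_t _; set p := 2 ^+ ncoins P; lra.
Qed.

End Segment.

(** * Counting slices *)

Lemma count_prefix (A : Type) (a : pred A) (s : seq A) c :
  (c <= count a s)%N -> exists s1 s2, s = s1 ++ s2 /\ count a s1 = c.
Proof.
elim: s c => [|x s IH] c /=.
  by rewrite leqn0 => /eqP ->; exists [::], [::].
case: c => [|c]; first by exists [::], (x :: s).
case ax: (a x); rewrite ?add1n ?ltnS ?add0n => /IH [s1 [s2 [-> e]]];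
  by exists (x :: s1), s2; rewrite /= ax e.
Qed.

(** Peel off prefixes that communicate exactly [c] bits; the extra [c] on the right accounts for the
    last, incomplete slice. *)
Lemma slice_outputs l r n (P : program l r n) c k :
  (0 < c)%N ->
  (forall P1 Q P2, P = P1 ++ Q ++ P2 -> (comm Q <= c)%N ->
     (size (output_keys Q) <= k)%N) ->
  (size (output_keys P) * c <= k * (comm P + c))%N.
Proof.
move=> c0 slice.
suff suffix N P1 P0 : (size P0 <= N)%N -> P = P1 ++ P0 ->
    (size (output_keys P0) * c <= k * (comm P0 + c))%N.
  exact: (suffix (size P) [::] P).
elim: N P1 P0 => [|N IH] P1 P0 sz PE.
  by case: P0 sz {PE} => // _; rewrite mul0n.
have [le|lt] := leqP (comm P0) c.
  have := slice P1 P0 [::]; rewrite cats0 => /(_ PE le) {}slice.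
  by apply: leq_mul slice _; rewrite leq_addl.
have [Q [P' [P0E cQ]]] := @count_prefix _ (@is_comm l r n) P0 c (ltnW lt).
have cP0 : comm P0 = (c + comm P')%N by rewrite P0E /comm count_cat cQ.
have Qc : (size (output_keys Q) <= k)%N.
  by apply: (slice P1 Q P'); rewrite ?PE ?P0E // /comm cQ.
have szP' : (size P' <= N)%N.
  have : (0 < size Q)%N.
    by case: Q cQ {P0E Qc} => //= e; rewrite -e in c0.
  by move: sz; rewrite P0E size_cat; lia.
have := IH (P1 ++ Q) P' szP'; rewrite -catA -P0E => /(_ PE).
rewrite cP0 P0E /output_keys pmap_cat size_cat -/(output_keys Q) -/(output_keys P').
move: (leq_mul Qc (leqnn c)); lia.
Qed.

Lemma comm_lower_bound :
  exists2 K : nat, (0 < K)%N &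
  forall l r n S (P : program l r n), (0 < S)%N -> (n <= l * r)%N ->
    computes_DISJ P -> space_bounded P S -> (l * r * n <= K * S ^ 2 * comm P)%N.
Proof.
exists (4 * (36 * (7 * 3)) * (4 * (56 * 7)) ^ 2)%N => [|l r n S P S0 nlr computes space].
  by rewrite !muln_gt0.
set b := (36 * (7 * 3))%N; pose k := (4 * (56 * (7 * S)))%N.
have -> : (4 * b * (4 * (56 * 7)) ^ 2 * S ^ 2 = 4 * b * (k * k))%N.
  by rewrite /k !expnS !expn0 !muln1; ring.
have k0 : (0 < k)%N by rewrite /k; lia.
have b0 : (0 < b)%N by [].
have [_ szN] := computes_keys computes.
have NC : (l * r <= comm P)%N by rewrite -szN size_output_keys.
(* For small [n] it suffices that each of the [l * r] outputs costs a bit. *)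
have [lt|ge] := ltnP n (4 * b * k).
  rewrite [X in (_ <= X)%N]mulnC; apply: leq_mul => //.
  by apply: leq_trans (ltnW lt) _; rewrite mulnA leq_pmulr.
pose m := (n %/ k)%N; pose c := (m %/ b)%N.
have m4 : (4 * b <= m)%N by rewrite leq_divRL.
have c4 : (4 <= c)%N by rewrite leq_divRL.
have cm : (c * b <= m)%N by exact: leq_trunc_div.
have mk : (m * k <= n)%N by exact: leq_trunc_div.
have mc : (m < (c + 1) * b)%N by rewrite addn1 -ltn_divLR.
have nm : (n < (m + 1) * k)%N by rewrite addn1 -ltn_divLR.
have slice P1 Q P2 : P = P1 ++ Q ++ P2 -> (comm Q <= c)%N ->
    (size (output_keys Q) <= k)%N.
  move=> PE cQ; rewrite PE in computes space; apply: ltnW.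
  apply: (segment_outputs S0 (m := m) _ computes space).
  - by apply: leq_trans m4; rewrite muln_gt0.
  (* [4 <= c] gives [c + 7 <= 3 * c], whence the 3 in [b]. *)
  - by apply: leq_trans cm; rewrite /b; lia.
  - by rewrite mulnC.
have c0 : (0 < c)%N by lia.
have := slice_outputs c0 slice; rewrite szN.
move: (l * r)%N (comm P) nlr NC => N C nN NC sliced.
(* As [2 * k <= n <= N], the incomplete slice takes at most half of [N * c]. *)
have half : (N * c <= 2 * k * C)%N.
  have : (2 * k * c <= N * c)%N.
    rewrite leq_mul2r; apply/orP; right; apply: leq_trans nN.
    apply: leq_trans ge; rewrite leq_mul2r; apply/orP; right.
    by rewrite (leq_mul (n1 := 4) (n2 := b) (m1 := 2) (m2 := 1)).
  by move: sliced; rewrite mulnDr; lia.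
have nle : (n <= 2 * (k * b) * c)%N.
  apply: leq_trans (ltnW nm) _.
  have : ((m + 1) * k <= ((c + 1) * b) * k)%N by rewrite leq_mul2r addn1 mc orbT.
  move=> /leq_trans; apply.
  have : (c + 1 <= 2 * c)%N by lia.
  move=> /(fun h => leq_mul h (leqnn (b * k)))=> h.
  by rewrite -mulnA; apply: leq_trans h _; rewrite leq_eqVlt; apply/orP; left; apply/eqP; ring.
apply: leq_trans (leq_mul (leqnn N) nle) _.
have := leq_mul (leqnn (2 * (k * b))) half.
move=> h; apply: leq_trans (leq_trans _ h) _; rewrite leq_eqVlt; apply/orP; left; apply/eqP; ring.
Qed.

Theorem mainTheorem13 :
  exists kappa : rat, 0 < kappa /\
    (forall (n S : nat) (P : program n n n),
        computes_DISJ P -> space_bounded P S ->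
        kappa * (n ^ 3)%N%:R / (S ^ 2)%N%:R <= (comm P)%:R) /\
    (forall (n S : nat) (P : program n 1 n),
        computes_DISJ P -> space_bounded P S ->
        kappa * (n ^ 2)%N%:R / (S ^ 2)%N%:R <= (comm P)%:R).
Proof.
have [K K0 bound] := comm_lower_bound.
have K0' : (0 : rat) < K%:R by rewrite ltr0n.
exists (K%:R^-1); split; first by rewrite invr_gt0.
have conv N S C : ((0 < S)%N -> (N <= K * S ^ 2 * C)%N) ->
    K%:R^-1 * N%:R / (S ^ 2)%N%:R <= C%:R :> rat.
  (* For [S = 0] the quotient is 0 by convention and the bound is trivial. *)
  case: S => [_|S /(_ isT) le]; first by rewrite invr0 mulr0 ler0n.
  rewrite ler_pdivrMr ?ltr0n ?expn_gt0 // mulrC ler_pdivrMr //.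
  by rewrite -!natrM ler_nat; apply: leq_trans le _; rewrite leq_eqVlt; apply/orP; left;
    apply/eqP; ring.
split=> n S P computes space; apply: conv => S0.
  have nn : (n <= n * n)%N by rewrite -{1}[n]muln1 leq_mul2l; case: (n).
  by have := bound _ _ _ _ P S0 nn computes space; rewrite -mulnA.
have n1 : (n <= n * 1)%N by rewrite muln1.
by have := bound _ _ _ _ P S0 n1 computes space; rewrite muln1.
Qed.
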